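(* For all $m,n\ge 1$, $\gamma_{\rm i}(P_m\,\square\,P_n)=\alpha(P_m\,\square\,P_n)=\lceil mn/2\rceil$.
   Context: $P_m$ is the path on $m$ vertices, $\square$ denotes the Cartesian product of graphs (so $P_m\,\square\,P_n$ is the $m\times n$ grid), and $\alpha$ is the independence number. Indicated domination game on a graph $G$: two players, Dominator and Staller, alternate. In each round Dominator indicates a vertex $v$ not yet dominated by the vertices previously selected by Staller (a vertex dominates itself and its neighbors), and Staller must select a vertex of the closed neighborhood $N[v]$, adding it to a set $D$. The game ends when $D$ is a dominating set of $G$. Dominator wants to minimize $|D|$ and Staller to maximize it; the size of $D$ under optimal play of both is the indicated domination number $\gamma_{\rm i}(G)$. *)

(* Defs.v *)
From mathcomp Require Import all_boot.
Set Implicit Arguments. Unset Strict Implicit. Unset Printing Implicit Defensive.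

Definition cnbhd (T : finType) (adj : rel T) (v : T) : {set T} :=
  [set u | (u == v) || adj v u].

Definition dominated (T : finType) (adj : rel T) (D : {set T}) (v : T) : bool :=
  [exists u in D, (u == v) || adj u v].

Definition dominating (T : finType) (adj : rel T) (D : {set T}) : bool :=
  [forall v, dominated adj D v].

(* Value of the indicated domination game from position D (the set of
   vertices selected so far), computed with a fuel parameter.  Each round
   Dominator indicates a vertex v not dominated by D, Staller selects a
   vertex u of N[v] (necessarily u \notin D), and D becomes u |: D.
   Dominator minimizes, Staller maximizes the number of further moves. *)
Fixpoint igame_val (T : finType) (adj : rel T) (fuel : nat) (D : {set T}) : nat :=
  if dominating adj D then 0 else
  match fuel with
  | 0 => 0
  | fuel'.+1 =>
      \big[minn/#|T|.+1]_(v | ~~ dominated adj D v)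
        \max_(u in cnbhd adj v) (igame_val adj fuel' (u |: D)).+1
  end.

(* Since every move adds a new vertex to D, the game lasts at most #|T|
   rounds, so fuel #|T| starting from the empty set is enough. *)
Definition indicated_domination_number (T : finType) (adj : rel T) : nat :=
  igame_val adj #|T| set0.

Definition independent (T : finType) (adj : rel T) (S : {set T}) : bool :=
  [forall x in S, forall y in S, ~~ adj x y].

Definition independence_number (T : finType) (adj : rel T) : nat :=
  \max_(S : {set T} | independent adj S) #|S|.

Definition path_adj (k : nat) : rel 'I_k :=
  fun a b => (a.+1 == b :> nat) || (b.+1 == a :> nat).

Definition box_adj (T1 T2 : finType) (e1 : rel T1) (e2 : rel T2) : rel (T1 * T2) :=
  fun x y => ((x.1 == y.1) && e2 x.2 y.2) || ((x.2 == y.2) && e1 x.1 y.1).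

Definition grid_adj (m n : nat) : rel ('I_m * 'I_n) :=
  box_adj (@path_adj m) (@path_adj n).
Arguments grid_adj m n : clear implicits.

(* Main.v *)
Require Import Defs.
From mathcomp Require Import all_boot.
From mathcomp Require Import zify.

Set Implicit Arguments. Unset Strict Implicit. Unset Printing Implicit Defensive.

(** Lower bound: Staller fixes a maximum independent set [S] and always answers
    inside [S]; the game can then only stop at [D = S].

    Upper bound: cut the grid into horizontal dominoes (and, when the number of
    columns is odd, cut the first column into vertical dominoes, plus a single
    cell if the number of rows is odd too).  Each domino has a pivot: its right,
    respectively lower, cell.  Dominator sweeps the grid from left to right (the
    first column from top to bottom), indicating the pivot of a domino both of
    whose cells are still undominated.  In this order none of the tiles meeting
    the closed neighbourhood of the indicated pivot contains a vertex selected
    before, so the selected vertices lie in distinct tiles.  When no such domino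
    is left, every tile without a selected vertex has at most one undominated
    cell, and one move per cell suffices.  The number of moves is thus at most
    the number of tiles, and every tile contains a cell of the larger colour
    class of the checkerboard, which is independent. *)

(** * Game values on an arbitrary graph *)

Lemma bigminn_leq (I : eqType) (r : seq I) (P : pred I) (F : I -> nat) x v :
  v \in r -> P v -> \big[minn/x]_(i <- r | P i) F i <= F v.
Proof.
elim: r => [|a r IH] //; rewrite inE big_cons => /orP[/eqP<- Pv|vr Pv].
  by rewrite Pv geq_minl.
case: ifP => _; last exact: IH.
by apply: leq_trans (geq_minr _ _) _; apply: IH.
Qed.

Section Game.

Variables (T : finType) (adj : rel T).

Lemma dominatedU1 (D : {set T}) u x :
  dominated adj (u |: D) x = [|| u == x, adj u x | dominated adj D x].
Proof.
apply/existsP/idP => [[w /andP[]]|].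
  rewrite in_setU1 => /orP[/eqP->|wD].
    by case/orP=> ->; rewrite ?orbT.
  by move=> h; apply/orP; right; apply/orP; right; apply/existsP; exists w; rewrite wD.
rewrite orbA => /orP[h|/existsP[w /andP[wD h]]].
  by exists u; rewrite setU11.
by exists w; rewrite in_setU1 wD orbT.
Qed.

Lemma igame_val_leS f (D : {set T}) v k :
  ~~ dominated adj D v ->
  (forall u, u \in cnbhd adj v -> igame_val adj f (u |: D) <= k) ->
  igame_val adj f.+1 D <= k.+1.
Proof.
move=> nv h /=; case: ifP => // _.
apply: leq_trans (bigminn_leq _ _ (mem_index_enum v) nv) _.
by apply/bigmax_leqP => u /h.
Qed.

Hypotheses (adj_sym : symmetric adj) (adj_irr : irreflexive adj).

Lemma igame_val_ge_independent (S D : {set T}) f :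
  independent adj S -> dominating adj S -> D \subset S -> #|S| - #|D| <= f ->
  #|S| - #|D| <= igame_val adj f D.
Proof.
move=> indS domS; elim: f D => [|f IH] D sDS le_f /=.
  by case: ifP.
case: ifP => [domD|_].
  suff /subset_leq_card : S \subset D by rewrite leqn0 subn_eq0.
  apply/subsetP => s sS; have /forallP/(_ s)/existsP[u /andP[uD]] := domD.
  case/orP => [/eqP<- //|us].
  have /forallP/(_ u) := indS; rewrite (subsetP sDS _ uD) => /forallP/(_ s).
  by rewrite sS us.
apply: (big_ind (fun k => #|S| - #|D| <= k)) => [|a b|v nv].
(* The default value [#|T|.+1] of the minimum exceeds the bound. *)
- exact: leqW (leq_trans (leq_subr _ _) (max_card _)).
- by rewrite leq_min => -> ->.
have /forallP/(_ v)/existsP[u /andP[uS uv]] := domS.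
have uN : u \in cnbhd adj v by rewrite inE adj_sym.
have nuD : u \notin D.
  by apply: contra nv => uD; apply/existsP; exists u; rewrite uD.
apply: leq_trans (leq_bigmax_cond _ uN).
have := IH (u |: D); rewrite subUset sub1set uS sDS cardsU1 nuD.
by move=> /(_ isT); lia.
Qed.

Lemma independence_number_le_indicated :
  independence_number adj <= indicated_domination_number adj.
Proof.
have ind0 : independent adj set0 by apply/forallP => x; rewrite inE.
rewrite /independence_number (bigmax_eq_arg set0) //.
case: arg_maxnP => //= S indS maxS.
(* A vertex not dominated by the maximum set [S] could be added to it. *)
have domS : dominating adj S.
  apply/forallP => v; apply: contraT => nv.
  have nadj u : u \in S -> ~~ adj u v.
    by move=> uS; apply: contra nv => uv; apply/existsP; exists u; rewrite uS uv orbT.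
  have nvS : v \notin S.
    by apply: contra nv => vS; apply/existsP; exists v; rewrite vS eqxx.
  have /maxS : independent adj (v |: S).
    apply/forallP => x; apply/implyP; rewrite in_setU1 => xS.
    apply/forallP => y; apply/implyP; rewrite in_setU1 => yS.
    case/predU1P: xS => [->|xS]; case/predU1P: yS => [->|yS]; rewrite ?adj_irr //.
    - by rewrite adj_sym nadj.
    - exact: nadj.
    by have /forallP/(_ x) := indS; rewrite xS => /forallP/(_ y); rewrite yS.
  by rewrite cardsU1 nvS ltnn.
have := @igame_val_ge_independent S set0 #|T| indS domS (sub0set _).
by rewrite cards0 subn0; apply; apply: max_card.
Qed.

(** Every answer to [v] dominates [v], so each round shrinks the undominated set. *)
Lemma igame_val_le_undominated f (D : {set T}) :
  igame_val adj f D <= #|[set x | ~~ dominated adj D x]|.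
Proof.
elim: f D => [|f IH] D; first by rewrite /=; case: ifP.
case domD: (dominating adj D); first by rewrite /= domD.
have /forallPn/=[v nv] := negbT domD.
rewrite (cardsD1 v) inE nv add1n.
apply: (igame_val_leS nv) => u; rewrite inE => uv.
apply: leq_trans (IH _) (subset_leq_card _).
apply/subsetP => x; rewrite !inE dominatedU1 !negb_or => /and3P[nux nadj ->].
rewrite andbT; apply: contraNneq nadj => xv; move: uv nux.
by rewrite xv adj_sym => /orP[->|].
Qed.

(** * Upper bound from a tiling swept by rank *)

Section Tiling.

Variables (I : finType) (tile : T -> I) (pivot : pred T) (rank : T -> nat).

Hypothesis tile_clique : forall x y, tile x = tile y -> x != y -> adj x y.
Hypothesis tile_pivot :
  forall x y, tile x = tile y -> x != y -> pivot x != pivot y.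
(* A vertex [s] selected earlier, when [v] was indicated, and lying in a tile
   that meets the closed neighbourhood of [v'], dominates part of the tile of [v']. *)
Hypothesis tile_sweep : forall v v' s x,
  pivot v -> pivot v' -> v != v' -> rank v <= rank v' ->
  s \in cnbhd adj v -> x \in cnbhd adj v' -> tile s = tile x ->
  exists2 y, tile y = tile v' & s \in cnbhd adj y.

Definition open_pivot (D : {set T}) (v : T) : bool :=
  pivot v && [forall y, (tile y == tile v) ==> ~~ dominated adj D y].

Lemma open_pivot_undominated (D : {set T}) v :
  open_pivot D v -> ~~ dominated adj D v.
Proof. by case/andP => _ /forallP/(_ v); rewrite eqxx. Qed.

(** Invariant of the sweep: [v] stands for the pivot indicated when [s] was selected, and its rank
    bound feeds [tile_sweep]. *)
Definition swept (D : {set T}) : Prop :=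
  {in D &, injective tile} /\
  forall s, s \in D -> exists v, [/\ pivot v, s \in cnbhd adj v
    & forall v', open_pivot D v' -> rank v <= rank v'].

Lemma sub_open_pivot (D : {set T}) u v :
  open_pivot (u |: D) v -> open_pivot D v.
Proof.
case/andP => pv /forallP h; rewrite /open_pivot pv.
apply/forallP => y; apply/implyP => /(implyP (h y)).
by rewrite dominatedU1 !negb_or => /and3P[].
Qed.

Lemma dominated_cnbhd (D : {set T}) s y :
  s \in D -> s \in cnbhd adj y -> dominated adj D y.
Proof.
by move=> sD; rewrite inE adj_sym => h; apply/existsP; exists s; rewrite sD.
Qed.

(** If [u] shared a tile with an earlier [s], then by [tile_sweep] [s] would dominate a cell of the
    tile of [v], which is still open. Open pivots only disappear, so rank bounds persist. *)
Lemma swept_step (D : {set T}) v u :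
  swept D -> open_pivot D v ->
  (forall v', open_pivot D v' -> rank v <= rank v') ->
  u \in cnbhd adj v -> u \notin D /\ swept (u |: D).
Proof.
move=> [injD rkD] ov minv uv; have /andP[pv /forallP whole] := ov.
have nv := open_pivot_undominated ov.
have newtile s : s \in D -> tile s <> tile u.
  move=> sD su; have [v0 [pv0 sv0 /(_ _ ov) rk0]] := rkD s sD.
  have nv0 : v0 != v by apply: contraNneq nv => <-; apply: dominated_cnbhd sD sv0.
  have [y yv sy] := tile_sweep pv0 pv nv0 rk0 sv0 uv su.
  by have := whole y; rewrite yv eqxx (dominated_cnbhd sD sy).
split; first by apply/negP => /newtile.
split=> [a b|s].
  rewrite !in_setU1 => /predU1P[->|aD] /predU1P[->|bD] // ab.
  - by case: (newtile b bD).
  - by case: (newtile a aD).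
  exact: injD.
case/setU1P => [->|sD]; last have [v0 [pv0 sv0 rk0]] := rkD s sD.
  by exists v; split=> // v' /sub_open_pivot/minv.
by exists v0; split=> // v' /sub_open_pivot/rk0.
Qed.

Lemma igame_val_le_swept f (D : {set T}) :
  swept D -> igame_val adj f D <= #|tile @: [set: T]| - #|D|.
Proof.
elim: f D => [|f IH] D sw; first by rewrite /=; case: ifP.
have [/existsP[v0 ov0]|none] := boolP [exists v, open_pivot D v].
  case: (arg_minnP rank ov0) => v ov minv.
  have nv := open_pivot_undominated ov.
  have step u := swept_step sw ov minv (u := u).
  have vv : v \in cnbhd adj v by rewrite inE eqxx.
  have [nvD [injv _]] := step v vv.
  have := subset_leq_card (imsetS tile (subsetT (v |: D))).
  rewrite (card_in_imset injv) cardsU1 nvD => ltD.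
  (* The bound is positive because [v |: D] still injects into the tiles. *)
  rewrite -(@prednK (_ - _)); last by rewrite subn_gt0.
  apply: igame_val_leS nv _ => u /step[nuD /IH].
  by rewrite cardsU1 nuD add1n subnS.
set U := [set x | ~~ dominated adj D x].
have injU : {in U &, injective tile}.
  (* [pivot] is two-valued, so a tile has at most two cells; if both are undominated, its pivot is
     open. *)
  have main x y : x \in U -> y \in U -> tile x = tile y -> pivot x -> x = y.
    rewrite !inE => nx ny xy px; apply/eqP; apply: contraNT none => nxy.
    apply/existsP; exists x; rewrite /open_pivot px; apply/forallP => z.
    apply/implyP => /eqP zx; have [->//|nzx] := eqVneq z x.
    have [->//|nzy] := eqVneq z y.
    have := tile_pivot xy nxy; have := tile_pivot zx nzx.
    have := tile_pivot (etrans zx xy) nzy.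
    by rewrite px; case: (pivot z); case: (pivot y).
  move=> x y xU yU xy; apply/eqP; apply: contraT => nxy.
  have := tile_pivot xy nxy; case px: (pivot x).
    by rewrite (main x y) ?eqxx in nxy.
  case py: (pivot y) => // _.
  by rewrite (main y x) ?eqxx // in nxy.
apply: leq_trans (igame_val_le_undominated _ _) _; rewrite -/U.
rewrite -(card_in_imset injU) -(card_in_imset sw.1) leq_subRL; last first.
  exact/subset_leq_card/imsetS/subsetT.
rewrite -cardsUI (_ : _ :&: _ = set0) ?cards0 ?addn0.
  by rewrite -imsetU; apply/subset_leq_card/imsetS/subsetT.
(* Tiles are cliques, so a selected [s] dominates its whole tile. *)
apply/setP => t; rewrite !inE; apply/negP => /andP[/imsetP[s sD ->]].
case/imsetP => x; rewrite inE => nx sx; case/negP: nx.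
apply/existsP; exists s; rewrite sD /=.
by have [//|nsx] := eqVneq s x; apply: tile_clique.
Qed.

Lemma indicated_domination_number_le_tiles :
  indicated_domination_number adj <= #|tile @: [set: T]|.
Proof.
rewrite -[X in _ <= X](subn0) -(cards0 T); apply: igame_val_le_swept.
by split=> [x y|x]; rewrite inE.
Qed.

End Tiling.

End Game.

(** * Tiling and colouring of the grid *)

Lemma grid_adjE m n (x y : 'I_m * 'I_n) :
  grid_adj m n x y =
    (x.1 == y.1 :> nat) && ((x.2.+1 == y.2 :> nat) || (y.2.+1 == x.2 :> nat)) ||
    (x.2 == y.2 :> nat) && ((x.1.+1 == y.1 :> nat) || (y.1.+1 == x.1 :> nat)).
Proof. by []. Qed.

Lemma grid_adj_sym m n : symmetric (grid_adj m n).
Proof. by move=> x y; rewrite !grid_adjE; lia. Qed.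

Lemma eq_cellE m n (x y : 'I_m * 'I_n) :
  (x == y) = (x.1 == y.1 :> nat) && (x.2 == y.2 :> nat).
Proof. by []. Qed.

Section Grid.

Variables m n : nat.

(* Shifting the columns by one when [n] is even makes the horizontal dominoes
   occupy columns [2k+1, 2k+2] in both cases; only odd [n] has a column [0]. *)
Definition shifted_col (x : 'I_m * 'I_n) : nat := x.2 + ~~ odd n.

(** Second coordinate 0 marks the vertical tiles, since [uphalf] of a positive column is positive.
    [inord] requires successor bounds. *)
Definition grid_tile (x : 'I_m * 'I_n) : 'I_m.+1 * 'I_n.+1 :=
  if shifted_col x == 0 then (inord (x.1)./2, ord0)
  else (inord x.1, inord (uphalf (shifted_col x))).

Definition grid_pivot (x : 'I_m * 'I_n) : bool :=
  if shifted_col x == 0 then odd x.1 else ~~ odd (shifted_col x).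

(** The offset [m] puts column 0 before all other columns. *)
Definition grid_rank (x : 'I_m * 'I_n) : nat :=
  if shifted_col x == 0 then val x.1 else m + shifted_col x.

(** The parity makes the single-cell tile, present when [m] and [n] are odd, black. *)
Definition grid_black : {set 'I_m * 'I_n} :=
  [set x : 'I_m * 'I_n | ~~ odd (x.1 + shifted_col x)].

Lemma grid_tileP (x y : 'I_m * 'I_n) :
  grid_tile x = grid_tile y <->
  (shifted_col x = 0 /\ shifted_col y = 0 /\ (x.1)./2 = (y.1)./2) \/
  (0 < shifted_col x /\ 0 < shifted_col y /\
   x.1 = y.1 :> nat /\ uphalf (shifted_col x) = uphalf (shifted_col y)).
Proof.
have [xm xn] := (ltn_ord x.1, ltn_ord x.2); have [ym yn] := (ltn_ord y.1, ltn_ord y.2).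
have pairE (a c : 'I_m.+1) (b d : 'I_n.+1) :
    (a, b) = (c, d) <-> (a = c :> nat) /\ (b = d :> nat).
  by split=> [[-> ->]|[/ord_inj-> /ord_inj->]].
rewrite /grid_tile; case: eqP => cx; case: eqP => cy;
  rewrite pairE ?inordK /=; move: cx cy; rewrite /shifted_col; lia.
Qed.

Lemma grid_tile_clique x y :
  grid_tile x = grid_tile y -> x != y -> grid_adj m n x y.
Proof.
move/grid_tileP; rewrite grid_adjE eq_cellE /shifted_col; lia.
Qed.

Lemma grid_tile_pivot x y :
  grid_tile x = grid_tile y -> x != y -> grid_pivot x != grid_pivot y.
Proof.
move/grid_tileP; rewrite eq_cellE /grid_pivot => t nxy.
rewrite negb_eqb; case: ifP => cx; case: ifP => cy; move: t nxy cx cy;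
  rewrite /shifted_col; lia.
Qed.

Lemma grid_tile_sweep (v v' s x : 'I_m * 'I_n) :
  grid_pivot v -> grid_pivot v' -> v != v' -> grid_rank v <= grid_rank v' ->
  s \in cnbhd (grid_adj m n) v -> x \in cnbhd (grid_adj m n) v' ->
  grid_tile s = grid_tile x ->
  exists2 y, grid_tile y = grid_tile v' & s \in cnbhd (grid_adj m n) y.
Proof.
have := ltn_ord v'.1; rewrite /grid_pivot /grid_rank !inE !eq_cellE !grid_adjE.
move=> vm pv pv' nvv' rk sv xv' /grid_tileP sx.
have [c0'|c_gt0'] := posnP (shifted_col v').
  (* The rank puts [v] in column 0 above [v'], so the shared tile can only be that of [v']. *)
  exists s; last by rewrite inE eqxx.
  apply/grid_tileP; move: pv pv' rk; rewrite c0' /=.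
  have [c0|c_gt0] := posnP (shifted_col v).
    by move: sx c0 c0'; rewrite /shifted_col; lia.
  by lia.
move: pv' rk; rewrite gtn_eqF // => pv' rk.
(* A shared tile to the right of [v'] would force [v] and [v'] into the same row and column. *)
have [sgt0 sblk srow] : [/\ 0 < shifted_col s,
    uphalf (shifted_col s) = uphalf (shifted_col v')
    & s.1 <= v'.1.+1 /\ v'.1 <= s.1.+1].
  have [c0|c_gt0] := posnP (shifted_col v).
    by move: pv c_gt0' pv' sx c0; rewrite /shifted_col; split; lia.
  move: pv rk; rewrite gtn_eqF // => pv rk.
  by move: c_gt0 c_gt0' pv pv' rk sx; rewrite /shifted_col; split; lia.
exists (v'.1, s.2); first by apply/grid_tileP; right.
by rewrite inE eq_cellE grid_adjE /=; lia.
Qed.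

Lemma grid_tile_black (x : 'I_m * 'I_n) :
  exists2 y, y \in grid_black & grid_tile y = grid_tile x.
Proof.
have [xm xn] := (ltn_ord x.1, ltn_ord x.2).
have [bx|wx] := boolP (x \in grid_black); first by exists x.
move: wx; rewrite inE negbK => wx.
have [c0|c_neq0] := eqVneq (shifted_col x) 0.
  (* A white cell of column 0 has an odd row, so its partner lies above. *)
  have lt : (x.1).-1 < m by lia.
  exists (Ordinal lt, x.2).
    by rewrite inE /=; move: wx c0; rewrite /shifted_col /=; lia.
  by apply/grid_tileP; move: wx c0; rewrite /shifted_col /=; lia.
have [oc|ec] := boolP (odd (shifted_col x)).
  (* The last shifted column is even, so a right neighbour exists. *)
  have lt : (x.2).+1 < n by move: oc; rewrite /shifted_col; lia.
  exists (x.1, Ordinal lt); first by rewrite inE; move: wx; rewrite /shifted_col /=; lia.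
  by apply/grid_tileP; move: wx oc; rewrite /shifted_col /=; lia.
have lt : (x.2).-1 < n by lia.
exists (x.1, Ordinal lt).
  by rewrite inE; move: wx ec c_neq0; rewrite /shifted_col /=; lia.
by apply/grid_tileP; move: wx ec c_neq0; rewrite /shifted_col /=; lia.
Qed.

Lemma independent_grid_black : independent (grid_adj m n) grid_black.
Proof.
apply/forallP => x; apply/implyP; rewrite inE => bx.
apply/forallP => y; apply/implyP; rewrite inE => yb.
move: bx yb; rewrite grid_adjE /shifted_col; lia.
Qed.

Lemma card_grid_black : #|grid_black| = (m * n).+1 %/ 2.
Proof.
have row a k : \sum_(j < k) ~~ odd (a + j) = if odd a then k./2 else uphalf k.
  elim: k => [|k IH]; first by rewrite big_ord0 if_same.
  by rewrite big_ord_recr /= IH oddD; case: (odd a) => /=; lia.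
have rows b k : \sum_(i < k) (if odd (i + b) then n./2 else uphalf n) =
    if odd b then k./2 * uphalf n + uphalf k * n./2
    else uphalf k * uphalf n + k./2 * n./2.
  elim: k => [|k IH]; first by rewrite big_ord0 !mul0n if_same.
  rewrite big_ord_recr /= IH oddD !(uphalf_half k).
  by case: (odd k); case: (odd b); rewrite /= ?mulnDl ?mulSn; lia.
rewrite -sum1dep_card big_mkcond /=.
rewrite -(pair_bigA _ (fun (i : 'I_m) (j : 'I_n) =>
  if ~~ odd (i + (j + ~~ odd n)) then 1 else 0)) /=.
transitivity (\sum_(i < m) (if odd (i + ~~ odd n) then n./2 else uphalf n)).
  apply: eq_bigr => i _; rewrite -row; apply: eq_bigr => j _.
  by rewrite addnAC addnA; case: odd.
have := odd_double_half m; have := odd_double_half n.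
rewrite rows !uphalf_half; case: (odd n); case: (odd m) => /= <- <-; nia.
Qed.

End Grid.

Theorem theorem5p4 (m n : nat) :
  0 < m -> 0 < n ->
  indicated_domination_number (grid_adj m n) = independence_number (grid_adj m n) /\
  independence_number (grid_adj m n) = (m * n).+1 %/ 2.
Proof.
move=> _ _; rewrite -card_grid_black.
have irr : irreflexive (grid_adj m n) by move=> x; rewrite grid_adjE; lia.
have alpha_le := independence_number_le_indicated (@grid_adj_sym m n) irr.
have black_le : #|grid_black m n| <= independence_number (grid_adj m n).
  exact: leq_bigmax_cond (independent_grid_black m n).
have game_le : indicated_domination_number (grid_adj m n) <= #|grid_black m n|.
  apply: leq_trans (indicated_domination_number_le_tiles (@grid_adj_sym m n)
    (@grid_tile_clique m n) (@grid_tile_pivot m n) (@grid_tile_sweep m n)) _.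
  apply: leq_trans (leq_imset_card (@grid_tile m n) (mem (grid_black m n))).
  apply/subset_leq_card/subsetP => _ /imsetP[x _ ->].
  by have [y yB <-] := grid_tile_black x; apply: imset_f.
(* The three inequalities form a cycle. *)
lia.
Qed.
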